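(* Let $n \geq 5$ and let $T \subseteq S_n$ be a set of transpositions that generates $S_n$. Suppose that the transposition graph $G(T)$ is not isomorphic to the complete graph $K_n$. Then $\operatorname{Aut}(\operatorname{Cay}(S_n,T)) = R(S_n) \rtimes \operatorname{Aut}(S_n,T)$ (internal semidirect product of subgroups, with $R(S_n)$ the normal factor), implying that $\operatorname{Cay}(S_n,T)$ is normal.
   Context: $S_n$ is the symmetric group on $[n]=\{1,\dots,n\}$, and a transposition is a permutation $(i\,j)$ with $i\neq j$. The transposition graph $G(T)$ is the simple graph with vertex set $[n]$ and edge set $E(T)=\{\{i,j\} : (i\,j)\in T\}$. For a finite group $H$ and a generating subset $T\subseteq H$ with $T=T^{-1}$ and $\mathrm{id}\notin T$, the Cayley graph $\operatorname{Cay}(H,T)$ is the simple undirected graph with vertex set $H$ and edge set $\{\{a,ta\} : a\in H,\ t\in T\}$. $\operatorname{Aut}(\operatorname{Cay}(H,T))$ is its group of graph automorphisms. The right regular representation is $R(H)=\{\rho_a : a\in H\}$, where $\rho_a$ is the map $b\mapsto ba$ on $H$; it is a subgroup of $\operatorname{Aut}(\operatorname{Cay}(H,T))$. $\operatorname{Aut}(H)$ is the group of group automorphisms of $H$ and $\operatorname{Aut}(H,T)=\{f\in\operatorname{Aut}(H) : f(T)=T\}$, which is also a subgroup of $\operatorname{Aut}(\operatorname{Cay}(H,T))$. The Cayley graph $\operatorname{Cay}(H,T)$ is called normal if $R(H)$ is a normal subgroup of $\operatorname{Aut}(\operatorname{Cay}(H,T))$. *)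

(* Defs.v *)
From HB Require Import structures.
From mathcomp Require Import all_boot all_fingroup.

Set Implicit Arguments.
Unset Strict Implicit.
Unset Printing Implicit Defensive.

Local Open Scope group_scope.

(* A finite simple graph with vertex set a finType V is given by its set of
   edges E : {set {set V}}, whose members are two-element sets. *)

Section Graphs.

Variables V W : finType.

Definition graph_isomorphic (E : {set {set V}}) (F : {set {set W}}) : Prop :=
  exists2 f : V -> W, bijective f & [set f @: e | e : {set V} in E] = F.

Definition complete_graph : {set {set V}} := [set e : {set V} | #|e| == 2].

Definition graph_aut (E : {set {set V}}) : {set {perm V}} :=
  [set p : {perm V} | [set p @: e | e : {set V} in E] == E].

Lemma graph_aut_group_set (E : {set {set V}}) : group_set (graph_aut E).
Proof.
apply/group_setP; split=> [|p q].
  rewrite inE; apply/eqP; rewrite -[RHS]imset_id; apply: eq_imset => e.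
  by rewrite -[RHS]imset_id; apply: eq_imset => x; rewrite perm1.
rewrite !inE => /eqP Ep /eqP Eq; apply/eqP.
rewrite -[RHS]Eq -[in RHS]Ep -imset_comp; apply: eq_imset => e /=.
by rewrite -imset_comp; apply: eq_imset => x; rewrite /= permM.
Qed.

Canonical graph_aut_group E := group (graph_aut_group_set E).

End Graphs.

Arguments complete_graph V : clear implicits.

Section Cayley.

Variable gT : finGroupType.
Implicit Type T : {set gT}.

(* The edges are two-element sets as soon as 1 \notin T. For gT = 'S_n note that
   t * a is the permutation x |-> a (t x); inversion, which fixes every
   transposition, exchanges this product with the right-to-left one. *)
Definition cayley_graph T : {set {set gT}} :=
  [set [set a; t * a] | a in [set: gT], t in T].

(* The action 'R sends (b, a) to b * a. *)
Definition right_regular : {set {perm gT}} := actperm 'R @* [set: gT].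

Canonical right_regular_group := [group of right_regular].

Definition aut_fixing T : {set {perm gT}} :=
  [set f : {perm gT} in Aut [set: gT] | f @: T == T].

Lemma aut_fixing_group_set T : group_set (aut_fixing T).
Proof.
apply/group_setP; split=> [|f g].
  apply/setIdP; split; first exact: group1.
  apply/eqP; rewrite -[RHS]imset_id.
  by apply: eq_imset => x; rewrite perm1.
move=> /setIdP[Af /eqP fT] /setIdP[Ag /eqP gTT].
apply/setIdP; split; first exact: groupM.
apply/eqP; rewrite -[RHS]gTT -[in RHS]fT -imset_comp.
by apply: eq_imset => x; rewrite /= permM.
Qed.

Canonical aut_fixing_group T := group (aut_fixing_group_set T).

Definition normal_cayley T : bool := right_regular <| graph_aut (cayley_graph T).

End Cayley.

Arguments right_regular gT : clear implicits.

Section Transpositions.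

Variable n : nat.

Definition transpositions : {set 'S_n} :=
  [set tperm i j | i in 'I_n, j in 'I_n & i != j].

Definition transposition_graph (T : {set 'S_n}) : {set {set 'I_n}} :=
  [set [set i; j] | i in 'I_n, j in 'I_n & (i != j) && (tperm i j \in T)].

End Transpositions.

Arguments transpositions n : clear implicits.

(* Main.v *)
(* Write edge x y for (x y) \in T and let f be an automorphism fixing 1. For
   s, t in T the common neighbours of s and t in the Cayley graph are
   {1, ts} if s and t commute, {1, ts, st} if s, t and s^t form a triangle of the
   transposition graph, and {1} otherwise. Hence f acts on T preserving
   commutation and triangles, so (Whitney) this action is conjugation by a
   permutation. Applied at every vertex a, this yields phi a with
   f (s * a) = s ^ phi a * f a for all s in T, and f is a group automorphism as
   soon as the action of phi a on T does not depend on a.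
   Comparing phi (t * a) with phi a for t = (i j): either they agree on T, or
   their quotient is an automorphism of the transposition graph that swaps i and
   j, fixes the edges avoiding i and j and the common neighbours of i and j, and
   puts every other neighbour of i or j in a 4-cycle with the edge ij. If there
   is such a 4-cycle i j k l, then n >= 5 forces k and l to have degree two and
   none of jk, kl, li can change phi. If there is none, triangles propagate the
   swap to all edges at i, and the transposition graph is complete. So the edges
   that never change phi still generate the symmetric group, and phi is constant
   on T. *)

Require Import Defs.
From mathcomp Require Import all_boot all_fingroup.
Set Implicit Arguments.
Unset Strict Implicit.
Unset Printing Implicit Defensive.
Local Open Scope group_scope.

(** * Products of two transpositions *)

Section Words.

Variable X : finType.
Implicit Types (p q s t e : {perm X}) (i j k l x y z : X).

Definition is_tperm p : Prop := exists i j : X, i != j /\ p = tperm i j.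

Lemma is_tperm_invol p : is_tperm p -> p * p = 1.
Proof. by case=> i [j [_ ->]]; apply: tperm2. Qed.

Lemma is_tpermV p : is_tperm p -> p^-1 = p.
Proof. by case=> i [j [_ ->]]; rewrite tpermV. Qed.

Lemma is_tperm_moved p x : is_tperm p -> p x != x -> p = tperm x (p x).
Proof.
case=> i [j [nij ->]]; case: tpermP => [->|->|_ _]; rewrite ?eqxx //.
by rewrite tpermC.
Qed.

Lemma is_tperm_neq1 p : is_tperm p -> p != 1.
Proof.
case=> i [j [nij ->]]; apply: contraNneq nij => /permP/(_ i).
by rewrite tpermL perm1 => ->.
Qed.

Lemma is_tpermJ p q : is_tperm p -> is_tperm (p ^ q).
Proof.
case=> i [j [nij ->]]; exists (q i), (q j); split; last by rewrite tpermJ.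
by rewrite (inj_eq perm_inj).
Qed.

(** If [p] moved [x], then [q] would have to carry [p x] back to [x], so both would be the
    transposition of [x] and [p x], with product 1. *)
Lemma fact_moved p q x :
  is_tperm p -> is_tperm q -> p * q != 1 -> (p * q) x = x -> p x = x /\ q x = x.
Proof.
move=> Tp Tq pq1 pqx; have [px|px] := eqVneq (p x) x.
  by split=> //; rewrite -[in RHS]pqx permM px.
case/eqP: pq1; rewrite (is_tperm_moved Tp px).
have qpx : q (p x) = x by rewrite -permM.
have qpx' : q (p x) != p x by rewrite qpx eq_sym.
by rewrite [q in LHS](is_tperm_moved Tq qpx') qpx (tpermC (p x)) tperm2.
Qed.

(** Permutations of an abstract [X] do not reduce, so words in transpositions are evaluated on
    positions in a list of distinct points, where factorizations can be searched by computation. *)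
Definition swapn (a b x : nat) : nat :=
  if x == a then b else if x == b then a else x.

Definition evalw (w : seq (nat * nat)) (x : nat) :=
  foldl (fun (y : nat) c => swapn c.1 c.2 y) x w.

(** One-letter words have their own branch so that no trailing factor 1 appears and an explicit word
    is convertible to the product written in a goal. *)
Fixpoint interp (x0 : X) (v : seq X) (w : seq (nat * nat)) : {perm X} :=
  if w is c :: w' then
    if w' is [::] then tperm (nth x0 v c.1) (nth x0 v c.2)
    else tperm (nth x0 v c.1) (nth x0 v c.2) * interp x0 v w'
  else 1.

Definition in_range m (w : seq (nat * nat)) :=
  all (fun c => (c.1 < m) && (c.2 < m)) w.

Lemma swapn_lt m a b (x : nat) : a < m -> b < m -> x < m -> swapn a b x < m.
Proof. by rewrite /swapn => *; do 2?case: ifP => //. Qed.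

Lemma evalw_lt m w (x : nat) : in_range m w -> x < m -> evalw w x < m.
Proof.
elim: w x => //= c w IH x /andP[/andP[c1 c2] cw] xm.
by apply: IH => //; apply: swapn_lt.
Qed.

Lemma interpE x0 (v : seq X) w (x : nat) :
  uniq v -> in_range (size v) w -> x < size v ->
  interp x0 v w (nth x0 v x) = nth x0 v (evalw w x).
Proof.
move=> Uv; elim: w x => [|c w IH] x /=; first by rewrite perm1.
case/andP=> /andP[c1 c2] cw xm.
have tE : tperm (nth x0 v c.1) (nth x0 v c.2) (nth x0 v x)
        = nth x0 v (swapn c.1 c.2 x).
  rewrite permE /= !nth_uniq // /swapn.
  by case: ifP => // _; case: ifP.
case: w IH cw => [|c' w] IH cw; first exact: tE.
by rewrite permM tE IH //; apply: swapn_lt.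
Qed.

Lemma interp_out x0 (v : seq X) w x : in_range (size v) w -> x \notin v ->
  interp x0 v w x = x.
Proof.
move=> + xv; have xn a : a < size v -> nth x0 v a != x.
  by move=> av; apply: contraNneq xv => <-; apply: mem_nth.
elim: w => [|c w IH] /=; first by rewrite perm1.
case/andP=> /andP[c1 c2] cw.
case: w IH cw => [|c' w] IH cw; first by rewrite tpermD ?xn.
by rewrite permM tpermD ?xn ?IH.
Qed.

(* [R] is a property shared by all the factorizations of the word [w] into two
   transpositions of [0, m). *)
Definition check_fact m w (R : nat * nat -> nat * nat -> bool) :=
  [&& in_range m w, has (fun x : nat => evalw w x != x) (iota 0 m) &
   all (fun a => all (fun b => all (fun c => all (fun d =>
     all (fun x : nat => evalw w x == evalw [:: (a, b); (c, d)] x) (iota 0 m)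
     ==> R (a, b) (c, d))
   (iota 0 m)) (iota 0 m)) (iota 0 m)) (iota 0 m)].

(** The word moves a point, so the product is not 1 and by [fact_moved] both factors move only
    points of [v]. They are thus named by pairs of positions, which [check_fact] searches
    exhaustively. *)
Lemma fact_word x0 (v : seq X) w R p q :
    uniq v -> check_fact (size v) w R ->
    is_tperm p -> is_tperm q -> interp x0 v w = p * q ->
  exists c d : nat * nat, [/\ p = interp x0 v [:: c], q = interp x0 v [:: d]
    & R c d].
Proof.
move=> Uv /and3P[wm /hasP[x xm /negP wx] chk] Tp Tq pq.
rewrite mem_iota /= add0n in xm.
have pq1 : p * q != 1.
  apply/negP=> /eqP pq1; apply: wx.
  rewrite -(nth_uniq x0 _ _ Uv) ?evalw_lt // -interpE // pq pq1 perm1 eqxx //.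
have supp r : is_tperm r -> (forall y, (p * q) y = y -> r y = y) ->
    exists c, in_range (size v) [:: c] /\ r = interp x0 v [:: c].
  case=> i [j [nij rE]] sr.
  have mem y : r y != y -> y \in v.
    apply: contraNT => yv; apply/eqP; apply: sr.
    by rewrite -pq (interp_out x0 wm).
  have iv : i \in v by apply: mem; rewrite rE tpermL eq_sym.
  have jv : j \in v by apply: mem; rewrite rE tpermR.
  exists (index i v, index j v); rewrite /= !index_mem iv jv; split=> //.
  by rewrite !nth_index.
have [||c [commb pE]] := supp p => //.
  by move=> y /(fact_moved Tp Tq pq1) [].
have [||d [dm qE]] := supp q => //.
  by move=> y /(fact_moved Tp Tq pq1) [].
exists c, d; split=> //.
case: c d => [a b] [c d] in pE qE commb dm *.
move: (commb) (dm); rewrite /= !andbT => /andP[am bm] /andP[commb' dm'].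
move/allP: chk => /(_ a); rewrite mem_iota => /(_ am).
move/allP => /(_ b); rewrite mem_iota => /(_ bm).
move/allP => /(_ c); rewrite mem_iota => /(_ commb').
move/allP => /(_ d); rewrite mem_iota => /(_ dm') /implyP; apply.
apply/allP=> y; rewrite mem_iota add0n => /= ym.
have rg : in_range (size v) [:: (a, b); (c, d)] by rewrite /= am bm commb' dm'.
rewrite -(nth_uniq x0 _ _ Uv) ?(evalw_lt wm ym) ?(evalw_lt rg ym) //.
by rewrite -(interpE x0 Uv wm ym) -(interpE x0 Uv rg ym) pq pE qE.
Qed.

(** * Commuting pairs, triangles and factorizations *)

Definition commb p q := p * q == q * p.

Lemma commbC p q : commb p q = commb q p.
Proof. exact: eq_sym. Qed.

Variant tperm_pair p q : Prop :=
  | TpermEq of p = q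
  | TpermDisj i j k l of uniq [:: i; j; k; l] & p = tperm i j & q = tperm k l
  | TpermAdj i j k of uniq [:: i; j; k] & p = tperm i j & q = tperm i k.

Lemma tperm_pairP p q : is_tperm p -> is_tperm q -> tperm_pair p q.
Proof.
move=> Tp Tq; have [i [j [nij pE]]] := Tp.
have adj x y : x != y -> p = tperm x y -> q x != x -> tperm_pair p q.
  move=> nxy pE' qx; have qE := is_tperm_moved Tq qx.
  have [e|n] := eqVneq (q x) y; first by apply: TpermEq; rewrite qE e.
  apply: (TpermAdj (i := x) (j := y) (k := q x)) => //=.
  by rewrite !inE negb_or nxy [x == _]eq_sym qx eq_sym n.
have [qi|] := eqVneq (q i) i; last exact: adj pE.
have [qj|qj] := eqVneq (q j) j; last first.
  by apply: (adj j i) qj; rewrite 1?eq_sym // pE tpermC.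
have [k [l [nkl qE]]] := Tq.
apply: (TpermDisj (i := i) (j := j) (k := k) (l := l)) => //=.
rewrite !inE !negb_or nij nkl /= andbT.
have nik z : q z = z -> (z != k) && (z != l).
  move=> qz; apply/andP; split; apply: contra_neq nkl => e;
  by move: qz; rewrite e qE ?tpermL ?tpermR.
by rewrite !nik.
Qed.

Lemma uniq3P (i j k : X) : uniq [:: i; j; k] -> [/\ i != j, i != k & j != k].
Proof. by rewrite /= !inE negb_or andbT => /andP[/andP[]]. Qed.

Lemma uniq4P (i j k l : X) : uniq [:: i; j; k; l] ->
  [/\ i != j, i != k & i != l] /\ [/\ j != k, j != l & k != l].
Proof.
by rewrite /= !inE !negb_or andbT => /and3P[/and3P[? ? ?] /andP[? ?] ?].
Qed.

Lemma tperm_disj_commb i j k l :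
  uniq [:: i; j; k; l] -> commb (tperm i j) (tperm k l).
Proof.
case/uniq4P=> [[_ ik il] [jk jl _]].
apply/eqP/esym; rewrite conjgC; congr (_ * _).
by rewrite tpermJ !tpermD.
Qed.

Lemma tperm_adjJ i j k :
  uniq [:: i; j; k] -> tperm i j ^ tperm i k = tperm j k.
Proof.
by case/uniq3P=> ij _ jk; rewrite tpermJ tpermL tpermD ?(eq_sym k) // tpermC.
Qed.

Lemma tperm_adj_ncommb i j k :
  uniq [:: i; j; k] -> ~~ commb (tperm i j) (tperm i k).
Proof.
case/uniq3P=> ij ik jk; apply/negP=> /eqP/permP/(_ i).
by rewrite !permM !tpermL !tpermD // 1?eq_sym // => /eqP; rewrite (negPf jk).
Qed.

Lemma uniq_adjC i j k : uniq [:: i; j; k] -> uniq [:: i; k; j].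
Proof. by rewrite /= !inE !negb_or !andbT (eq_sym k) [(i != j) && _]andbC. Qed.

Lemma tperm_braid s t :
  is_tperm s -> is_tperm t -> ~~ commb s t -> s ^ t = t ^ s.
Proof.
move=> Ts Tt; case: (tperm_pairP Ts Tt) => [->|i j k l U -> ->|i j k U -> ->].
- by [].
- by rewrite tperm_disj_commb.
- by rewrite (tperm_adjJ U) (tperm_adjJ (uniq_adjC U)) (tpermC j k).
Qed.

Lemma is_tpermJE s t : is_tperm t -> s ^ t = t * s * t.
Proof. by move=> Tt; rewrite conjgE is_tpermV // mulgA. Qed.

Lemma fact_disj i j k l p q : uniq [:: i; j; k; l] ->
    is_tperm p -> is_tperm q -> tperm i j * tperm k l = p * q ->
  p = tperm i j \/ p = tperm k l.
Proof.
move=> U Tp Tq e.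
(* Each transposition has two names as an ordered pair of positions. *)
have [|c [d [-> _]]] := @fact_word i _ [:: (0, 1); (2, 3)]%N
  (fun c _ => c \in [:: (0, 1); (1, 0); (2, 3); (3, 2)]%N) p q U _ Tp Tq e.
  by vm_compute.
rewrite !inE => /or4P[] /eqP -> /=; rewrite 1?tpermC; by [left|right].
Qed.

Lemma fact_adj i j k p q : uniq [:: i; j; k] ->
    is_tperm p -> is_tperm q -> tperm i j * tperm i k = p * q ->
  [\/ p = tperm i j, p = tperm i k | p = tperm j k].
Proof.
move=> U Tp Tq e.
have [|c [d [-> _]]] := @fact_word i _ [:: (0, 1); (0, 2)]%N
  (fun c _ => c \in [:: (0, 1); (1, 0); (0, 2); (2, 0); (1, 2); (2, 1)]%N)
  p q U _ Tp Tq e.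
  by vm_compute.
rewrite !inE => /or4P[/eqP->|/eqP->|/eqP->|/or3P[]/eqP->] /=;
by rewrite 1?tpermC; constructor.
Qed.

Lemma fact_ncommb s t p q : is_tperm s -> is_tperm t -> ~~ commb s t ->
    is_tperm p -> is_tperm q -> s * t = p * q ->
  [\/ p = s, p = t | p = s ^ t].
Proof.
move=> Ts Tt + Tp Tq.
case: (tperm_pairP Ts Tt) => [->|i j k l U -> ->|i j k U -> ->].
- by rewrite /commb eqxx.
- by rewrite tperm_disj_commb.
- by rewrite (tperm_adjJ U) => _; apply: fact_adj.
Qed.

(** Conjugation by [e] turns [tperm v w] into [tperm (e v) (e w)], so commuting means preserving the
    pair; swapping it is excluded by [e != tperm v w]. *)
Lemma commb_tpermE e (v w : X) : is_tperm e -> v != w -> e != tperm v w ->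
  commb e (tperm v w) = (e v == v) && (e w == w).
Proof.
move=> Te vw ne.
have -> : commb e (tperm v w) = (tperm (e v) (e w) == tperm v w).
  by rewrite -tpermJ /commb (conjgC (tperm v w) e) (inj_eq (mulgI e)) eq_sym.
apply/eqP/andP=> [E|[/eqP-> /eqP->] //].
have ev : e v == v.
  apply: contraR ne => ev.
  rewrite [e in e == _](is_tperm_moved Te ev); apply/eqP; congr (tperm _ _).
  move/permP/(_ (e v)): E; rewrite tpermL; case: tpermP => //.
  - by move=> e' _; rewrite e' eqxx in ev.
  - by move=> _ _ /perm_inj e'; rewrite e' eqxx in vw.
split=> //; move/permP/(_ (e v)): E.
by rewrite tpermL (eqP ev) tpermL => ->.
Qed.

(** A further edge meeting both [v w] and [v u] passes through [v] or is the third side [w u]. The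
    star of [v] is thus recognised from commutation and triangles alone. *)
Lemma tperm_star s t e (v w u : X) : uniq [:: v; w; u] ->
    s = tperm v w -> t = tperm v u -> is_tperm e -> e != s -> e != t ->
  (e v != v) = [&& ~~ commb e s, ~~ commb e t & e != s ^ t].
Proof.
move=> U -> -> Te; rewrite tperm_adjJ //.
case/uniq3P: U => vw vu wu es et.
rewrite !commb_tpermE // !negb_and.
have [ev|ev] := eqVneq (e v) v => /=.
  apply/esym/negP=> /and3P[ew eu]; rewrite (is_tperm_moved Te ew).
  have -> : e w = u; last by rewrite eqxx.
  apply/eqP; apply: contraNT eu => eu; apply/eqP.
  by rewrite (is_tperm_moved Te ew) tpermD.
by apply/esym; apply: contraNneq ev => ->; rewrite tpermD // eq_sym.
Qed.

End Words.

(** * Automorphisms of Cayley graphs *)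

Section CayleyAut.

Variables (gT : finGroupType) (T : {set gT}).
Hypotheses (T1 : 1 \notin T) (TV : forall t, t \in T -> t^-1 \in T).
Implicit Types (a b : gT) (f : {perm gT}).

Lemma cayley_edgeE a b : ([set a; b] \in cayley_graph T) = (b * a^-1 \in T).
Proof.
apply/imset2P/idP=> [[c t _ tT E]|bT]; last first.
  by exists a (b * a^-1); rewrite ?inE // mulgKV.
have nt : t * c != c.
  by apply: contraNneq T1 => /eqP; rewrite eq_mulgV1 mulgK => /eqP <-.
have /setP/(_ c) := E; have /setP/(_ (t * c)) := E.
have /setP/(_ a) := E; have /setP/(_ b) := E.
rewrite !inE !eqxx !orbT /= => /esym/orP bE /esym/orP aE /orP tcE /orP cE.
case: cE => /eqP cE; subst c.
  case: bE => /eqP bE; last by rewrite bE mulgK.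
  by case: tcE nt => /eqP->; rewrite ?bE eqxx.
case: aE => /eqP aE; last by rewrite aE invMg mulgA mulgV mul1g TV.
by case: tcE nt => /eqP->; rewrite ?aE eqxx.
Qed.

Lemma graph_autP f :
  reflect (forall a b, (f b * (f a)^-1 \in T) = (b * a^-1 \in T))
          (f \in graph_aut (cayley_graph T)).
Proof.
have im2 a b : f @: [set a; b] = [set f a; f b] by rewrite imsetU1 imset_set1.
rewrite inE; apply: (iffP eqP) => [fE a b|fE].
  rewrite -!cayley_edgeE -[in LHS]fE -im2 mem_imset //.
  exact: imset_inj perm_inj.
apply/eqP; rewrite eqEcard card_imset ?leqnn ?andbT; last first.
  exact: imset_inj perm_inj.
apply/subsetP=> _ /imsetP[_ /imset2P[a t _ tT ->] ->].
by rewrite im2 cayley_edgeE fE mulgK.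
Qed.

Lemma right_regularE f :
  reflect (exists a, forall b, f b = b * a) (f \in right_regular gT).
Proof.
apply: (iffP morphimP) => [[a _ _ ->]|[a fE]].
  by exists a => b; rewrite actpermE.
by exists a; rewrite ?inE //; apply/permP=> b; rewrite actpermE fE.
Qed.

Definition right_mul a : {perm gT} := actperm 'R a.

Lemma right_mulE a b : right_mul a b = b * a.
Proof. by rewrite /right_mul actpermE. Qed.

Lemma right_mul_aut a : right_mul a \in graph_aut (cayley_graph T).
Proof.
by apply/graph_autP=> b c; rewrite !right_mulE invMg mulgA mulgK.
Qed.

Definition conj_perm (g : gT) : {perm gT} := actperm 'J g.

Lemma conj_permE g b : conj_perm g b = b ^ g.
Proof. by rewrite /conj_perm actpermE. Qed.

Lemma conj_perm_aut g :
  (forall s, s \in T -> s ^ g \in T) ->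
  conj_perm g \in graph_aut (cayley_graph T).
Proof.
move=> gT'; have gTE : T :^ g = T.
  apply/eqP; rewrite eqEcard cardJg leqnn andbT.
  by apply/subsetP=> _ /imsetP[s sT ->]; apply: gT'.
apply/graph_autP=> b c; rewrite !conj_permE -conjVg -conjMg.
by rewrite -[in LHS]gTE memJ_conjg.
Qed.

Lemma conj_perm_aut_fixing g :
  (forall s, s \in T -> s ^ g \in T) -> conj_perm g \in aut_fixing T.
Proof.
move=> gT'; apply/setIdP; split.
  rewrite inE; apply/andP; split; first by apply/subsetP=> x; rewrite inE.
  by apply/morphicP=> x y _ _; rewrite !conj_permE conjMg.
rewrite eqEcard card_imset ?leqnn ?andbT; last exact: perm_inj.
by apply/subsetP=> _ /imsetP[s sT ->]; rewrite conj_permE gT'.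
Qed.

(** Translations are transitive, so every automorphism is a translation times one fixing 1. Group
    automorphisms fix 1, which no nontrivial translation does. *)
Lemma cayley_aut_sdprod :
    (forall f, f \in graph_aut (cayley_graph T) -> f 1 = 1 ->
       f \in aut_fixing T) ->
  right_regular gT ><| aut_fixing T = graph_aut (cayley_graph T).
Proof.
move=> stab.
have fixM f : f \in aut_fixing T -> {morph f : a b / a * b}.
  case/setIdP=> /setIdP[_ /morphicP fM] _ a b.
  by apply: fM; rewrite inE.
have fix1 f : f \in aut_fixing T -> f 1 = 1.
  by move/fixM=> fM; apply: (mulgI (f 1)); rewrite -fM !mulg1.
have fixV f a : f \in aut_fixing T -> f a^-1 = (f a)^-1.
  move=> fA; apply: (mulgI (f a)).
  by rewrite -fixM // !mulgV fix1.
have sub_fix : aut_fixing T \subset graph_aut (cayley_graph T).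
  apply/subsetP=> f fA; apply/graph_autP=> a b.
  rewrite -fixV // -fixM //; case/setIdP: fA => _ /eqP fT.
  by rewrite -{1}fT mem_imset //; apply: perm_inj.
rewrite sdprodE.
- apply/setP=> f; apply/mulsgP/idP.
    case=> r h /right_regularE[a rE] hA ->; apply: groupM.
      have -> : r = right_mul a by apply/permP=> b; rewrite rE right_mulE.
      exact: right_mul_aut.
    exact: (subsetP sub_fix).
  move=> fA.
  (* The left factor acts first: 1 goes to [f^-1 1], then back to 1. *)
  have rf : right_mul (f^-1 1) * f \in graph_aut (cayley_graph T).
    by rewrite groupM ?right_mul_aut.
  exists (right_mul (f^-1 1))^-1 (right_mul (f^-1 1) * f).
  - by rewrite groupV; apply/right_regularE; exists (f^-1 1); apply: right_mulE.
  - by apply: stab => //; rewrite permM right_mulE mul1g permKV.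
  - by rewrite mulKg.
- apply/subsetP=> h hA; rewrite inE; apply/subsetP=> _ /imsetP[r rR ->].
  have /right_regularE[a rE] := rR; apply/right_regularE; exists (h a) => b.
  by rewrite !permM rE fixM // permKV.
apply/trivgP/subsetP=> f /setIP[/right_regularE[a fE] fA].
move: (fix1 f fA); rewrite fE mul1g => a1; rewrite inE; apply/eqP/permP=> b.
by rewrite fE a1 mulg1 perm1.
Qed.

End CayleyAut.

(** * Cayley graphs generated by transpositions *)

Section TranspositionCayley.

Variables (X : finType) (T : {set {perm X}}).
Hypotheses (Ttp : forall t, t \in T -> is_tperm t) (Tgen : <<T>> = setT).
Implicit Types (p q s t a b g w : {perm X}) (f : {perm {perm X}}).
Implicit Types (x y z i j k l : X).

Definition edge x y := tperm x y \in T.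
Local Notation A := (graph_aut (cayley_graph T)).

Lemma one_notinT : 1 \notin T.
Proof. by apply/negP=> /Ttp/is_tperm_neq1; rewrite eqxx. Qed.

Lemma TV t : t \in T -> t^-1 \in T.
Proof. by move=> tT; rewrite is_tpermV //; apply: Ttp. Qed.

Lemma autP f : f \in A ->
  forall a b, (f b * (f a)^-1 \in T) = (b * a^-1 \in T).
Proof. by move/(graph_autP one_notinT TV). Qed.

Lemma TK t : t \in T -> t * t = 1.
Proof. by move/Ttp/is_tperm_invol. Qed.

Lemma edge_sym x y : edge x y = edge y x.
Proof. by rewrite /edge tpermC. Qed.

Lemma edge_neq x y : edge x y -> x != y.
Proof. by apply: contraTneq => ->; rewrite /edge tperm1 one_notinT. Qed.

Lemma edge_perm s : s \in T -> exists i j, edge i j /\ s = tperm i j.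
Proof.
by move=> sT; have [i [j [_ sE]]] := Ttp sT; exists i, j; rewrite /edge -sE.
Qed.

Lemma edge_moved s x : s \in T -> s x != x -> edge x (s x) /\ s = tperm x (s x).
Proof.
by move=> sT sx; have sE := is_tperm_moved (Ttp sT) sx; rewrite /edge -sE.
Qed.

Lemma mulg_tp1 s t : s \in T -> t \in T -> s != t -> s * t != 1.
Proof.
move=> sT tT; apply: contraNneq => /(congr1 (fun p => p * t)).
by rewrite -mulgA TK // mulg1 mul1g => ->.
Qed.

Lemma ncommb_neq s t : ~~ commb s t -> s != t.
Proof. by apply: contraNneq => ->; apply: eqxx. Qed.

Lemma sub_gen_ind (S : {set {perm X}}) (P : {perm X} -> Prop) :
    <<S>> = setT -> P 1 ->
    (forall a s, s \in S -> P a -> P (a * s)) ->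
  forall a, P a.
Proof.
move=> Sgen P1 PM a; have: a \in <<S>> by rewrite Sgen inE.
case/gen_prodgP=> m [c cS ->].
elim: m c cS => [|m IH] c cS; first by rewrite big_ord0.
by rewrite big_ord_recr; apply: PM => //; apply: IH.
Qed.

(** [tperm x z] is a word in [T] that carries [x] to [z]; each letter fixes the current point or
    moves it along an edge. *)
Lemma edge_connected (B : pred X) x :
  B x -> (forall y z, B y -> edge y z -> B z) -> forall z, B z.
Proof.
move=> Bx BE z; rewrite -(tpermL x z); move: (tperm x z).
apply: (sub_gen_ind Tgen); first by rewrite perm1.
move=> a s sT Ba; rewrite permM.
have [->//|sa] := eqVneq (s (a x)) (a x).
by apply: BE Ba _; have [] := edge_moved sT sa.
Qed.

(** * Common neighbours of two generators *)

Definition common_nbrs s t := [set w | (w * s^-1 \in T) && (w * t^-1 \in T)].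

Lemma imset_common_nbrs f s t :
  f \in A -> f @: common_nbrs s t = common_nbrs (f s) (f t).
Proof.
move=> fA; apply/setP=> w.
rewrite -[w](permKV f) mem_imset; last exact: perm_inj.
by rewrite !inE !autP.
Qed.

(** Since [q] is an involution, [p * s = q * t] amounts to [q * p = t * s], so the factorization
    lemmas list the common neighbours. *)
Lemma common_nbrs_fact s t w : s \in T -> t \in T -> w \in common_nbrs s t ->
  exists p q, [/\ p \in T, q \in T, t * s = q * p, w = p * s & w = q * t].
Proof.
move=> sT tT; rewrite inE => /andP[pT qT].
exists (w * s^-1), (w * t^-1); split; rewrite ?mulgKV //.
rewrite (is_tpermV (Ttp sT)) -{2}(is_tpermV (Ttp sT)) -(is_tpermV (Ttp qT)).
by rewrite invMg invgK mulgA mulgKV (is_tpermV (Ttp sT)).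
Qed.

Lemma common_nbrs_commb s t : s \in T -> t \in T -> s != t -> commb s t ->
  common_nbrs s t = [set 1; t * s].
Proof.
move=> sT tT nst /eqP cst; apply/setP=> w; rewrite !inE.
apply/idP/idP=> [wC|].
  have {wC}: w \in common_nbrs s t by rewrite inE.
  case/(common_nbrs_fact sT tT)=> p [q [pT qT e wp wq]].
  case: (tperm_pairP (Ttp tT) (Ttp sT)) => [ts|i j k l U tE sE|i j k U tE sE].
  - by rewrite ts eqxx in nst.
  - rewrite tE sE in e.
    case: (fact_disj U (Ttp qT) (Ttp pT) e) => qE.
      by rewrite wq qE -tE TK // eqxx.
    by rewrite wq qE -sE cst eqxx orbT.
  - by case/negP: (tperm_adj_ncommb U); rewrite -tE -sE /commb cst.
by case/orP=> /eqP->; rewrite ?mul1g ?TV // mulgK -cst mulgK sT tT.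
Qed.

Lemma common_nbrs_ncommb s t : s \in T -> t \in T -> ~~ commb s t ->
  common_nbrs s t = if s ^ t \in T then [set 1; t * s; s * t] else [set 1].
Proof.
move=> sT tT ncst.
have C1 : 1 \in common_nbrs s t by rewrite inE !mul1g !TV.
have [Ts Tt] := (Ttp sT, Ttp tT).
have nct : ~~ commb t s by rewrite commbC.
have sub w : w \in common_nbrs s t ->
    w = 1 \/ s ^ t \in T /\ (w = t * s \/ w = s * t).
  case/(common_nbrs_fact sT tT)=> p [q [pT qT e wp wq]].
  case: (fact_ncommb Tt Ts nct (Ttp qT) (Ttp pT) e) => qE.
  - by left; rewrite wq qE TK.
  - have pE : p = s ^ t.
      by rewrite tperm_braid // is_tpermJE // -mulgA e qE mulgA TK ?mul1g.
    by right; split; [rewrite -pE | right; rewrite wq qE].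
  - right; rewrite tperm_braid //; split; first by rewrite -qE.
    by left; rewrite wq qE -tperm_braid // is_tpermJE // -!mulgA TK ?mulg1.
apply/setP=> w; apply/idP/idP=> [/sub[->|[-> []->]]|].
- by case: ifP; rewrite !inE eqxx.
- by rewrite !inE eqxx orbT.
- by rewrite !inE eqxx !orbT.
case: ifP => [stT|_]; last by rewrite inE => /eqP->.
rewrite !inE -orbA => /or3P[]/eqP->; first by rewrite !mul1g !TV.
  by rewrite mulgK tT (is_tpermV (Ttp tT)) -is_tpermJE ?stT //; apply: Ttp.
rewrite mulgK sT andbT (is_tpermV (Ttp sT)) -is_tpermJE; last exact: Ttp.
by rewrite -tperm_braid ?stT //; apply: Ttp.
Qed.

(** * Automorphisms fixing 1 preserve commutation and triangles *)

Section Stabilizer.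

Variable f : {perm {perm X}}.
Hypotheses (fA : f \in A) (f1 : f 1 = 1).

Lemma stab_T s : s \in T -> f s \in T.
Proof. by move=> sT; have := autP fA 1 s; rewrite f1 !invg1 !mulg1 => ->. Qed.

(** Two distinct commuting generators have two common neighbours, non-commuting ones have one or
    three. *)
Lemma stab_commb s t : s \in T -> t \in T -> commb s t -> commb (f s) (f t).
Proof.
move=> sT tT cst; have [->|nst] := eqVneq s t; first exact: eqxx.
have ts1 : 1 != t * s.
  by rewrite eq_sym mulg_tp1 // eq_sym.
have := card_imset (common_nbrs s t) (@perm_inj _ f).
rewrite imset_common_nbrs // (common_nbrs_commb sT tT nst cst) cards2 ts1.
move=> cardC.
apply/negPn/negP=> ncst; move: cardC.
rewrite common_nbrs_ncommb ?stab_T //; case: ifP => _; last by rewrite cards1.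
rewrite setUC cardsU1 cards2 !inE negb_or.
have nf := ncommb_neq ncst; have nf' : f t != f s by rewrite eq_sym.
rewrite mulg_tp1 ?stab_T // [1 == _]eq_sym mulg_tp1 ?stab_T //.
by rewrite -[f s * f t == _]/(commb (f s) (f t)) ncst.
Qed.

(** The vertex [t * s] is a common neighbour of [s] and [t] and is also adjacent to [s ^ t]. Its
    image is a product of [f s] and [f t] in some order, and its inverse factors with [f (s ^ t)]
    first; this leaves only the third side, as [f] is injective. *)
Lemma stab_third s t :
  s \in T -> t \in T -> ~~ commb s t -> ~~ commb (f s) (f t) ->
  s ^ t \in T -> f (s ^ t) = f s ^ f t.
Proof.
move=> sT tT ncst ncf stT.
have : t * s \in common_nbrs s t.
  by rewrite common_nbrs_ncommb // stT !inE eqxx orbT.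
rewrite -(mem_imset _ _ (@perm_inj _ f)) imset_common_nbrs //.
rewrite common_nbrs_ncommb ?stab_T //.
have nst := ncommb_neq ncst.
have ts1 : f (t * s) != 1.
  by rewrite -f1 (inj_eq perm_inj) mulg_tp1 // eq_sym.
have [Ts Tt] := (Ttp sT, Ttp tT).
have [Tfs Tft] := (Ttp (stab_T sT), Ttp (stab_T tT)).
case: ifP => [fstT|_]; last by rewrite inE (negPf ts1).
set m := f (s ^ t); have mT : m \in T by apply: stab_T.
have pT : f (t * s) * m \in T.
  rewrite -(is_tpermV (Ttp mT)) autP // (is_tpermV (Ttp stT)) tperm_braid //.
  by rewrite is_tpermJE // -!mulgA (mulgA s) TK // mul1g mulgA TK ?mul1g.
have [ms mt] : m != f s /\ m != f t.
  rewrite !(inj_eq perm_inj); split.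
    by apply: contraNneq ncst => e; rewrite /commb conjgC e.
  apply: contraNneq (ncst) => e; move: e; rewrite tperm_braid // => e.
  by rewrite commbC /commb conjgC e.
have fact p q : p \in T -> q \in T -> f (t * s) = q * p ->
    p * q = m * (f (t * s) * m).
  move=> p'T qT e; rewrite -[RHS]invgK invMg (is_tpermV (Ttp pT)).
  rewrite (is_tpermV (Ttp mT)) -mulgA TK // mulg1 e invMg !is_tpermV //;
  exact: Ttp.
have [Tm Tp] := (Ttp mT, Ttp pT).
rewrite !inE (negPf ts1) /= => /orP[]/eqP/fact e.
  have /fact_ncommb[] := e (stab_T sT) (stab_T tT) => //.
  - by move=> me; rewrite me eqxx in ms.
  - by move=> me; rewrite me eqxx in mt.
have ncf' : ~~ commb (f t) (f s) by rewrite commbC.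
have /fact_ncommb[] := e (stab_T tT) (stab_T sT) => //.
- by move=> me; rewrite me eqxx in mt.
- by move=> me; rewrite me eqxx in ms.
by rewrite (tperm_braid Tfs).
Qed.

End Stabilizer.

Lemma stab_invg f : f \in A -> f 1 = 1 -> f^-1 \in A /\ f^-1 1 = 1.
Proof. by move=> fA f1; split; [rewrite groupV | apply: (canLR (permK f))]. Qed.

Lemma stab_commbE f s t : f \in A -> f 1 = 1 -> s \in T -> t \in T ->
  commb (f s) (f t) = commb s t.
Proof.
move=> fA f1 sT tT; apply/idP/idP; last exact: stab_commb.
have [fA' f1'] := stab_invg fA f1.
by move/(stab_commb fA' f1'); rewrite !permK; apply; apply: stab_T.
Qed.

Lemma stab_thirdE f s t a : f \in A -> f 1 = 1 ->
    s \in T -> t \in T -> a \in T -> ~~ commb s t ->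
  (f a == f s ^ f t) = (a == s ^ t).
Proof.
move=> fA f1 sT tT aT ncst.
have ncf : ~~ commb (f s) (f t) by rewrite stab_commbE.
apply/eqP/eqP=> e; last by rewrite e stab_third // -e.
have [fA' f1'] := stab_invg fA f1.
rewrite -[a](permK f) e stab_third ?permK ?stab_T //.
by rewrite -e stab_T.
Qed.

(** * From the action on edges to a permutation of the vertices *)

Hypothesis cardX : 4 < #|X|.

(** Here the bound on [#|X|] enters: fewer than five points cannot be a whole connected component,
    since the graph is connected on at least five. *)
Lemma edge_boundary x (S : seq X) : size S < 5 -> x \in S ->
  exists y z, [/\ y \in S, z \notin S & edge y z].
Proof.
move=> sS xS; have [/existsP[y /existsP[z /and3P[]]]|] :=
  boolP [exists y, [exists z, [&& y \in S, z \notin S & edge y z]]].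
  by exists y, z.
rewrite negb_exists => /forallP ncl.
have allS : forall z, z \in S.
  apply: (@edge_connected (mem S) x) => //= y z yS Eyz.
  move/existsPn: (ncl y) => /(_ z); rewrite yS Eyz andbT /=.
  by rewrite negbK.
have : #|X| <= size S.
  apply: leq_trans (card_size S); apply/subset_leq_card/subsetP=> z _.
  exact: allS.
by move/leq_ltn_trans/(_ sS); rewrite ltnNge cardX.
Qed.

(** The images of two edges at [v] still do not commute, so they share a point, and [tperm_star]
    carries the star of [v] to the star of that point. *)
Lemma branch_image f (v w u : X) : f \in A -> f 1 = 1 ->
    edge v w -> edge v u -> w != u ->
  exists v', forall s, s \in T -> (f s v' != v') = (s v != v).
Proof.
move=> fA f1 Evw Evu wu.
have U : uniq [:: v; w; u] by rewrite /= !inE negb_or wu !edge_neq.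
have nc := tperm_adj_ncommb U.
have [fsT ftT] := (Ttp (stab_T fA f1 Evw), Ttp (stab_T fA f1 Evu)).
case: (tperm_pairP fsT ftT) => [e|i j k l U' sE tE|i j k U' sE tE].
- by rewrite -(stab_commbE fA f1) // e /commb eqxx in nc.
- by rewrite -(stab_commbE fA f1) // sE tE tperm_disj_commb in nc.
exists i => a aT; have [->|ns] := eqVneq a (tperm v w).
  have [ij _ _] := uniq3P U'.
  by rewrite sE !tpermL eq_sym ij eq_sym edge_neq.
have [->|nt] := eqVneq a (tperm v u).
  have [_ ik _] := uniq3P U'.
  by rewrite tE !tpermL eq_sym ik eq_sym edge_neq.
rewrite (tperm_star U' sE tE) ?(inj_eq perm_inj) //; last exact/Ttp/stab_T.
rewrite (tperm_star U erefl erefl (Ttp aT) ns nt).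
by rewrite !stab_commbE // stab_thirdE.
Qed.

(** What [branch_image] leaves open is a leaf [v] with neighbour [w]. Its image is the end of
    [f (tperm v w)] other than the image of [w]. *)
Lemma vertex_image f (v : X) : f \in A -> f 1 = 1 ->
  exists v', forall s, s \in T -> (f s v' != v') = (s v != v).
Proof.
move=> fA f1.
have [_ [w [/predU1P[->|//] wv Evw]]] :=
  @edge_boundary v [:: v] isT (mem_head _ _).
have [/existsP[u /andP[Evu nwu]]|] := boolP [exists u, edge v u && (w != u)].
  exact: branch_image Evw Evu nwu.
move/existsPn=> leaf.
have {}leaf s : s \in T -> s v != v -> s = tperm v w.
  move=> sT sv; have [Evs sE] := edge_moved sT sv.
  by move: (leaf (s v)); rewrite Evs /= negbK => /eqP->.
(* An edge leaving the pair [v], [w] cannot start at the leaf [v], so [w] has a second neighbour and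
   [branch_image] applies to it. *)
have [w' w'E] : exists w' : X, forall s, s \in T -> (f s w' != w') = (s w != w).
  have [y [z [yS zS Eyz]]] := @edge_boundary v [:: v; w] isT (mem_head _ _).
  rewrite !inE in yS zS; case/norP: zS => zv zw.
  apply: (@branch_image f w v z) => //; rewrite 1?edge_sym 1?eq_sym //.
  case/orP: yS => /eqP yE; rewrite yE in Eyz; last by rewrite edge_sym.
  have := leaf _ Eyz; rewrite tpermL => /(_ zv) /permP/(_ v).
  by rewrite !tpermL => zw'; rewrite zw' eqxx in zw.
set s := tperm v w in leaf; have sT : s \in T by [].
have fsw : f s w' != w' by rewrite w'E // tpermR eq_sym edge_neq // edge_sym.
have fsE := is_tperm_moved (Ttp (stab_T fA f1 sT)) fsw.
exists (f s w') => a aT; have [->|ns] := eqVneq a s.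
  by rewrite (inj_eq perm_inj) fsw tpermL eq_sym edge_neq.
have av : a v = v by apply/eqP; apply: contraNT ns => /(leaf a aT) ->.
rewrite av eqxx; apply/negbTE; rewrite negbK.
have Tfa := Ttp (stab_T fA f1 aT).
have nfs : f a != f s by rewrite (inj_eq perm_inj).
have wfs : w' != f s w' by rewrite eq_sym.
have [aw|aw] := eqVneq (f a w') w'.
  suff: commb (f a) (f s) by rewrite fsE commb_tpermE -?fsE // aw eqxx.
  have aw' : a w == w by apply: negbFE; rewrite -w'E // aw eqxx.
  rewrite stab_commbE // /s commb_tpermE ?av ?eqxx ?aw' ?(edge_neq Evw) //.
  exact: Ttp.
apply: contraNT nfs => afs.
rewrite [f a](is_tperm_moved Tfa aw) fsE; apply/eqP; congr (tperm _ _).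
apply/eqP; apply: contraNT afs => afs.
by rewrite (is_tperm_moved Tfa aw) tpermD.
Qed.

(** The vertex images assemble into a permutation: an edge leaving the pair [u], [v] lies in the
    star of exactly one of them, so distinct vertices have distinct images. *)
Lemma stab_conj f : f \in A -> f 1 = 1 ->
  exists g, forall s, s \in T -> f s = s ^ g.
Proof.
move=> fA f1; have [h hE] := fin_all_exists (fun v => vertex_image v fA f1).
have inj_h : injective h.
  move=> u v huv; apply/eqP; apply: contraT => nuv.
  have uvE s : s \in T -> (s u != u) = (s v != v).
    by move=> sT; rewrite -(hE u) // huv hE.
  have [y [z [yS zS Eyz]]] := @edge_boundary u [:: u; v] isT (mem_head _ _).
  rewrite !inE in yS zS; case/norP: zS => zu zv.
  have uz x : x != z -> tperm x z x != x by rewrite tpermL eq_sym.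
  case/orP: yS => /eqP yE; rewrite yE in Eyz; have := uvE _ Eyz.
    by rewrite tpermL zu tpermD ?eqxx.
  by rewrite tpermL zv tpermD ?eqxx // eq_sym.
exists (perm inj_h) => s sT; have [i [j [Eij sE]]] := edge_perm sT.
have ij := edge_neq Eij.
rewrite {2}sE tpermJ !permE.
have fsi : f s (h i) != h i by rewrite hE // sE tpermL eq_sym.
have fsj : f s (h j) != h j by rewrite hE // sE tpermR.
rewrite (is_tperm_moved (Ttp (stab_T fA f1 sT)) fsi); congr (tperm _ _).
apply/eqP; apply: contraNT fsj => fsj.
rewrite (is_tperm_moved (Ttp (stab_T fA f1 sT)) fsi) tpermD ?eqxx //.
by rewrite (inj_eq inj_h).
Qed.

(** * The local action of an automorphism at a vertex *)

Lemma conj_memT g s : (forall s, s \in T -> s ^ g \in T) ->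
  (s ^ g \in T) = (s \in T).
Proof.
move=> gT; have gTE : T :^ g = T.
  apply/eqP; rewrite eqEcard cardJg leqnn andbT.
  by apply/subsetP=> _ /imsetP[r rT ->]; apply: gT.
by rewrite -{1}gTE; apply: memJ_conjg.
Qed.

Lemma edge_conj g x y :
  (forall s, s \in T -> s ^ g \in T) -> edge (g x) (g y) = edge x y.
Proof. by move=> gT; rewrite /edge -tpermJ conj_memT. Qed.

(** Translating [a] and [f a] to 1 reduces to [stab_conj]. *)
Lemma local_conj f a : f \in A -> exists g,
  (forall s, s \in T -> s ^ g \in T) /\
  (forall s, s \in T -> f (s * a) = s ^ g * f a).
Proof.
move=> fA; pose f' := right_mul a * f * right_mul (f a)^-1.
have f'E b : f' b = f (b * a) * (f a)^-1 by rewrite !permM !right_mulE.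
have f'A : f' \in A.
  by rewrite !groupM ?right_mul_aut //; first [exact: one_notinT | exact: TV].
have f'1 : f' 1 = 1 by rewrite f'E mul1g mulgV.
have [g gE] := stab_conj f'A f'1.
exists g; split=> s sT; first by rewrite -gE ?stab_T.
by rewrite -gE // f'E mulgKV.
Qed.

(** * Automorphisms fixing 1 and each of its neighbours *)

Definition fixT f := [/\ f \in A, f 1 = 1 & forall s, s \in T -> f s = s].

Lemma fixT_common_nbrs f s t w : fixT f -> s \in T -> t \in T ->
  (f w \in common_nbrs s t) = (w \in common_nbrs s t).
Proof.
case=> fA f1 fT sT tT.
have := imset_common_nbrs s t fA; rewrite (fT s sT) (fT t tT) => {1}<-.
by rewrite mem_imset //; apply: perm_inj.
Qed.

Lemma fixT_mul_neq1 f s t : fixT f -> s \in T -> t \in T -> s != t ->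
  (f (s * t) == 1) = false.
Proof.
case=> _ f1 _ sT tT nst; apply/negbTE.
by rewrite -[X in _ != X]f1 (inj_eq perm_inj) mulg_tp1.
Qed.

Lemma fixT_commb f s t : fixT f -> s \in T -> t \in T -> commb s t ->
  f (s * t) = s * t.
Proof.
move=> ff sT tT cst; have [_ f1 _] := ff.
have [->|nst] := eqVneq s t; first by rewrite TK.
have: f (t * s) \in common_nbrs s t.
  by rewrite fixT_common_nbrs // common_nbrs_commb // !inE eqxx orbT.
rewrite common_nbrs_commb // !inE fixT_mul_neq1 //; last by rewrite eq_sym.
by move/eqP; rewrite -(eqP cst).
Qed.

Lemma fixT_third f s t : fixT f -> s \in T -> t \in T -> ~~ commb s t ->
  s ^ t \in T -> f (s * t) = s * t \/ f (s * t) = t * s.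
Proof.
move=> ff sT tT ncst stT.
have: f (s * t) \in common_nbrs s t.
  by rewrite fixT_common_nbrs // common_nbrs_ncommb // stT !inE eqxx orbT.
rewrite common_nbrs_ncommb // stT !inE fixT_mul_neq1 //; last exact: ncommb_neq.
by case/orP=> /eqP; [right | left].
Qed.

(** [bad] lists known non-edges, and the check says that every factorization uses one of them. With
    [bad] empty it says that the word is not a product of two transpositions at all. *)
Lemma no_fact x0 (v : seq X) (w bad : seq (nat * nat)) p q :
    uniq v -> all (fun c => ~~ edge (nth x0 v c.1) (nth x0 v c.2)) bad ->
    check_fact (size v) w
      (fun c d => has (mem [:: c; d; (c.2, c.1); (d.2, d.1)]) bad) ->
    p \in T -> q \in T -> interp x0 v w = p * q -> False.
Proof.
move=> Uv /allP nbad chk pT qT e.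
have [c [d [pE qE /hasP[b /nbad]]]] := fact_word Uv chk (Ttp pT) (Ttp qT) e.
have Ec : edge (nth x0 v c.1) (nth x0 v c.2) by rewrite /edge -[tperm _ _]pE.
have Ed : edge (nth x0 v d.1) (nth x0 v d.2) by rewrite /edge -[tperm _ _]qE.
move=> /negP nb; rewrite !inE => bE; apply: nb.
by case/or4P: bE => /eqP->; rewrite //= edge_sym.
Qed.

Definition local_at f t g := (forall s, s \in T -> s ^ g \in T) /\
  (forall s, s \in T -> f (s * t) = s ^ g * t).

Lemma fixT_local f t : fixT f -> t \in T ->
  exists2 g, local_at f t g & t ^ g = t.
Proof.
case=> fA f1 fT tT; have [g [gT gE]] := local_conj t fA.
exists g; first by split=> // s sT; rewrite gE // fT.
by apply: (mulIg t); rewrite TK // -[X in _ ^ _ * X](fT t tT) -gE // TK.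
Qed.

Lemma tperm_fix g i j : i != j -> tperm i j ^ g = tperm i j ->
  (g i = i /\ g j = j) \/ (g i = j /\ g j = i).
Proof.
rewrite tpermJ => ij /permP gij; have gi := gij (g i); move: gi.
have gj := gij (g j); move: gj; rewrite tpermL tpermR.
have nij : g i != g j by rewrite (inj_eq perm_inj).
case: tpermP => [gji|gji|]; first by right.
  by move=> gii; left.
by move=> _ _ e; rewrite e eqxx in nij.
Qed.

(** With [t = tperm i j] and [s = tperm j k], the braid relation gives a hexagon 1, [s], [t * s],
    [s * t * s], [s * t], [t]. That its image closes up is a factorization condition, which only the
    two listed actions of [g] satisfy. *)
Lemma fixT_path f i j k g : fixT f -> edge i j -> edge j k -> ~~ edge i k ->
    local_at f (tperm i j) g -> tperm i j ^ g = tperm i j -> i != k ->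
  [/\ g i = i, g j = j & g k = k] \/ [/\ g i = j, g j = i & edge k (g k)].
Proof.
move=> ff Eij Ejk nEik [gT gE] tg ik; have [fA f1 fT] := ff.
set t := tperm i j in gE tg *; set s := tperm j k.
have [h [hT hE] sh] := fixT_local ff Ejk.
have ncst : ~~ commb s t.
  rewrite /s /t (tpermC i); apply: tperm_adj_ncommb.
  rewrite /= !inE negb_or andbT (edge_neq Ejk) eq_sym (edge_neq Eij).
  by rewrite eq_sym ik.
have [Ts Tt] : is_tperm s /\ is_tperm t by split; apply: Ttp.
(* s^g * t and t^h * s are both adjacent to the image of s * t * s = t * s * t. *)
have [p [q [pT qT pq]]] : exists p q, [/\ p \in T, q \in T &
    s ^ g * t * s * t ^ h = q * p].
  pose x := s * t * s.
  have xE : x = t * (s * t).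
    by have := tperm_braid Ts Tt ncst; rewrite !is_tpermJE // /x mulgA => ->.
  exists (f x * (f (t * s))^-1), (f (s * t) * (f x)^-1); split.
  - by rewrite autP // /x -[_ * s]mulgA mulgK.
  - by rewrite autP // xE invMg mulKVg TV.
  rewrite [RHS]mulgA mulgKV gE // hE // invMg !is_tpermV ?mulgA //.
  exact: is_tpermJ.
have [ij jk] := (edge_neq Eij, edge_neq Ejk).
have gn x y : x != y -> g x != g y by rewrite (inj_eq perm_inj).
have hn x y : x != y -> h x != h y by rewrite (inj_eq perm_inj).
have gik := edge_conj i k gT; have hik := edge_conj i k hT.
have gjk := edge_conj j k gT; have hij := edge_conj i j hT.
have gki := gn _ _ ik; have gkj := gn _ _ jk.
have hik' := hn _ _ ik; have hij' := hn _ _ ij.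
move: pq; rewrite /s /t !tpermJ; move: gik gjk gki gkj hik hij hik' hij'.
have [[gi gj]|[gi gj]] := tperm_fix ij tg;
  have [[hj hk]|[hj hk]] := tperm_fix jk sh; rewrite ?gi ?gj ?hj ?hk;
  set k' := g k; set i' := h i; rewrite (negPf nEik) Eij Ejk.
all: move=> Eik' Ejk' ik' jk' Ei'1 Ei'2 i'1 i'2; rewrite -!mulgA => pq.
(* Positions 0 to 4 of the words stand for [i], [j], [k], [g k] and [h i]; the four-point list
   serves when [h i] is [i] or [g k]. *)
all: have pq4 wd bad Uv nb ch :=
  @no_fact i [:: i; j; k; k'] wd bad q p Uv nb ch qT pT.
all: have pq5 wd bad Uv nb ch :=
  @no_fact i [:: i; j; k; k'; i'] wd bad q p Uv nb ch qT pT.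
all: rewrite /= !inE !negb_or ij ik jk /= ?[i == i']eq_sym ?[j == i']eq_sym
  ?[k == i']eq_sym ?[k' == i']eq_sym in pq4 pq5.
- left; split=> //; apply/eqP; apply: contraT; rewrite eq_sym => kk'.
  rewrite ik' jk' kk' i'1 i'2 /= in pq4 pq5.
  have [i'i|i'i] := eqVneq i' i.
    case: (pq4 [:: (1, 3); (0, 1); (1, 2); (0, 1)]
               [:: (0, 2); (0, 3)])%N => //=.
    - by rewrite nEik Eik'.
    - by rewrite -pq i'i.
  have [i'k'|i'k'] := eqVneq i' k'.
    case: (pq4 [:: (1, 3); (0, 1); (1, 2); (3, 1)]
               [:: (0, 2); (0, 3)])%N => //=.
    - by rewrite nEik Eik'.
    - by rewrite -pq i'k'.
  case: (pq5 [:: (1, 3); (0, 1); (1, 2); (4, 1)] [::])%N => //=.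
  by rewrite i'i i'k'.
- left; split=> //; apply/eqP; apply: contraT; rewrite eq_sym => kk'.
  rewrite ik' jk' kk' i'1 i'2 /= in pq4 pq5.
  have i'i : i' != i by apply: contraFneq Ei'1 => ->.
  have i'k' : i' != k' by apply: contraFneq Ei'1 => ->; rewrite edge_sym.
  case: (pq5 [:: (1, 3); (0, 1); (1, 2); (4, 2)] [::])%N => //=.
  by rewrite i'i i'k'.
all: have kk' : k != k' by apply: contraNneq nEik => ->.
all: right; split=> //; apply: contraT => nEkk'.
all: rewrite ik' jk' kk' i'1 i'2 /= in pq4 pq5.
- have [i'i|i'i] := eqVneq i' i.
    case: (pq4 [:: (0, 3); (0, 1); (1, 2); (0, 1)]
               [:: (0, 2); (1, 3); (2, 3)])%N => //=.
    - by rewrite nEik Eik' nEkk'.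
    - by rewrite -pq i'i.
  have i'k' : i' != k' by apply: contraFneq Eik' => <-; rewrite edge_sym.
  case: (pq5 [:: (0, 3); (0, 1); (1, 2); (4, 1)] [::])%N => //=.
  by rewrite i'i i'k'.
- have i'i : i' != i by apply: contraFneq Ei'1 => ->.
  have i'k' : i' != k' by apply: contraNneq nEkk' => <-; rewrite edge_sym.
  case: (pq5 [:: (0, 3); (0, 1); (1, 2); (4, 2)] [::])%N => //=.
  by rewrite i'i i'k'.
Qed.

(** Without the edge [j k], this is [fixT_path] for the path [j i k]. With it, [fixT_third] makes
    the image of [tperm i k] under [g] either itself or [tperm j k]. *)
Lemma fixT_side f i j k g : fixT f -> edge i j -> edge i k -> k != j ->
    local_at f (tperm i j) g -> tperm i j ^ g = tperm i j ->
  (g i = i -> g k = k) /\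
  (g i = j -> if edge j k then g k = k else edge k (g k)).
Proof.
move=> ff Eij Eik kj gL tg; have ij := edge_neq Eij; have ik := edge_neq Eik.
have [gT gE] := gL.
have gn x y : x != y -> g x != g y by rewrite (inj_eq perm_inj).
case: ifP => [Ejk|/negbT nEjk]; last first.
  rewrite tpermC in gL tg; rewrite edge_sym in Eij.
  have jk : j != k by rewrite eq_sym.
  have [[gj gi gk]|[gj gi gk]] := fixT_path ff Eij Eik nEjk gL tg jk.
    by split=> // e; rewrite -e gi eqxx in ij.
  by split=> // e; rewrite -e gi eqxx in ij.
have U : uniq [:: i; k; j] by rewrite /= !inE negb_or ij ik kj.
have ncst := tperm_adj_ncommb U; have st := tperm_adjJ U.
have stT : tperm i k ^ tperm i j \in T by rewrite st [_ \in T]edge_sym.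
have {stT} := fixT_third ff Eik Eij ncst stT.
have := gn _ _ ik; have := gn _ _ kj.
have tp_eq x y z : x != y -> tperm x y = tperm x z -> y = z.
  by move=> xy /permP/(_ x); rewrite !tpermL.
rewrite gE // (conjgCV (tperm i j)) tpermV st tpermJ => gkj gik.
case=> /mulIg e; split=> gi; rewrite gi in gik e.
- exact: tp_eq e.
- move/permP/(_ j): e; rewrite tpermL tpermD // => e.
  by rewrite e eqxx in gik.
- move/permP/(_ i): e; rewrite tpermL tpermD 1?eq_sym // => e.
  by rewrite e eqxx in gik.
- by apply: tp_eq gik _; rewrite e tpermC.
Qed.

(** * Flips, squares and twins *)

Definition flips g i j :=
  [/\ forall s, s \in T -> s ^ g \in T, g i = j, g j = i,
  forall s, s \in T -> s i = i -> s j = j -> s ^ g = s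
  & forall k, k != i -> k != j -> edge i k || edge j k ->
      if edge i k && edge j k then g k = k else edge k (g k)].

(** Edges avoiding [i] and [j] commute with [tperm i j] and are fixed by [fixT_commb]; those at [i]
    or [j] are governed by [fixT_side]. *)
Lemma fixT_dichotomy f i j g : fixT f -> edge i j ->
    local_at f (tperm i j) g -> tperm i j ^ g = tperm i j ->
  (forall s, s \in T -> s ^ g = s) \/ flips g i j.
Proof.
move=> ff Eij gL tg; have ij := edge_neq Eij; have [gT gE] := gL.
have Eji : edge j i by rewrite edge_sym.
have side1 k (kj : k != j) (Eik : edge i k) :=
  @fixT_side f i j k g ff Eij Eik kj gL tg.
have side2 k (ki : k != i) (Ejk : edge j k) : (g j = j -> g k = k) /\
    (g j = i -> if edge i k then g k = k else edge k (g k)).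
  by apply: (@fixT_side f j i k g ff Eji Ejk ki); rewrite (tpermC j).
have off s : s \in T -> s i = i -> s j = j -> s ^ g = s.
  move=> sT si sj; apply: (mulIg (tperm i j)); rewrite -gE // fixT_commb //.
  rewrite commb_tpermE ?si ?sj ?eqxx //; first exact: Ttp.
  by apply: contraNneq ij => sE; move: si; rewrite sE tpermL => ->.
have [[gi gj]|[gi gj]] := tperm_fix ij tg; [left=> s sT | right].
  have [si|si] := eqVneq (s i) i; last first.
    have [Eis sE] := edge_moved sT si; rewrite sE tpermJ gi.
    have [->|sij] := eqVneq (s i) j; first by rewrite gj.
    by rewrite (side1 _ sij Eis).1.
  have [sj|sj] := eqVneq (s j) j; first exact: off.
  have [Ejs sE] := edge_moved sT sj; rewrite sE tpermJ gj.
  have [->|sji] := eqVneq (s j) i; first by rewrite gi.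
  by rewrite (side2 _ sji Ejs).1.
split=> // k ki kj; have [Eik _|/negPf nEik /= Ejk] := boolP (edge i k).
  exact: (side1 k kj Eik).2.
by have := (side2 k ki Ejk).2 gj; rewrite nEik.
Qed.

Lemma flips_sym g i j : flips g i j -> flips g j i.
Proof.
case=> gT gi gj off side; split=> // [s sT sj si|k kj ki]; first exact: off.
by rewrite orbC andbC; apply: side.
Qed.

(** The order of the vertices matters: the 4-cycle is attached to the rest of the graph at both ends
    of its base [i j], and [k l] is the free opposite side. *)
Definition square i j k l :=
  [/\ [/\ edge i j, edge j k, edge k l & edge l i], i != k /\ j != l,
   (forall x, edge k x -> x = j \/ x = l),
   (forall x, edge l x -> x = i \/ x = k)
   & (exists x, [/\ edge j x, x != i, x != k & x != l]) /\
     (exists x, [/\ edge i x, x != j, x != k & x != l])].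

Lemma square_sym i j k l : square i j k l -> square j i l k.
Proof.
case=> [[Eij Ejk Ekl Eli] [ik jl] Nk Nl].
case=> [[x [Ejx xi xk xl]] [y [Eiy yj yk yl]]].
by split; [split; rewrite edge_sym | | | | split; [exists y | exists x]].
Qed.

(** [g] fixes edges avoiding [i] and [j], hence swaps [k] and [g k]. A further such edge at [k]
    would also be fixed, yet it does not contain [g k]; so [k], and by symmetry [g k], has degree
    two. *)
Lemma flips_square g i j k : flips g i j -> edge i j -> edge j k -> i != k ->
  ~~ edge i k -> square i j k (g k).
Proof.
case=> gT gi gj off side Eij Ejk ik nEik.
have [ij jk] := (edge_neq Eij, edge_neq Ejk).
have gE x y : edge (g x) (g y) = edge x y by apply: edge_conj.
have Ekl : edge k (g k).
  by have := side k; rewrite (negPf nEik) Ejk /= eq_sym ik eq_sym jk => ->.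
set l := g k in Ekl *.
have Eil : edge i l by rewrite -gj gE.
have nEjl : ~~ edge j l by rewrite -gi gE.
have il := edge_neq Eil.
have jl : j != l by rewrite -gi (inj_eq perm_inj).
have offE x y : x != i -> x != j -> y != i -> y != j -> edge x y ->
    tperm (g x) (g y) = tperm x y.
  by move=> xi xj yi yj Exy; rewrite -tpermJ off // tpermD.
have [ki kj] : k != i /\ k != j by rewrite !(eq_sym k).
have [li lj] : l != i /\ l != j by rewrite !(eq_sym l).
have gl : g l = k.
  by have /permP/(_ l) := offE k l ki kj li lj Ekl; rewrite tpermL tpermR.
have Nk x : edge k x -> x = j \/ x = l.
  move=> Ekx; have [->|xl] := eqVneq x l; [by right | left].
  apply/eqP; apply: contraT => xj.
  have xi : x != i by apply: contraNneq nEik => <-; rewrite edge_sym.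
  have /permP/(_ l) := offE k x ki kj xi xj Ekx.
  rewrite -/l tpermL tpermD ?(edge_neq Ekl) // => gx.
  by move: Ekx; rewrite -gE -/l gx => /edge_neq; rewrite eqxx.
have Nl x : edge l x -> x = i \/ x = k.
  rewrite -gE gl => /Nk[] gx; [left | right]; apply: (@perm_inj _ g).
    by rewrite gx gi.
  by rewrite gx.
(* A fifth point supplies an edge leaving the cycle, necessarily from [i] or [j]; [g] carries it to
   one leaving from the other. *)
have [x [y [xS yS Exy]]] := @edge_boundary i [:: i; j; k; l] isT (mem_head _ _).
move: xS yS; rewrite !inE !negb_or => xS /and4P[yi yj yk yl].
have gN z z' : g z = z' -> y != z -> g y != z'.
  by move=> <-; rewrite (inj_eq perm_inj).
have [[gyi gyj] gyk] := (gN _ _ gj yj, gN _ _ gi yi, gN _ _ gl yl).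
have gyl := gN k l erefl yk.
have Eiy : edge i y \/ edge j y.
  case/or4P: xS => /eqP xE; rewrite xE in Exy; [by left | by right | |].
    by case/Nk: Exy => yE; rewrite yE eqxx in yj yl.
  by case/Nl: Exy => yE; rewrite yE eqxx in yi yk.
split=> //; first by rewrite (edge_sym l).
case: Eiy => Ey.
  split; last by exists y.
  by exists (g y); split=> //; rewrite -gi gE.
split; first by exists y.
by exists (g y); split=> //; rewrite -gj gE.
Qed.

(** A flip would send the two neighbours [i] and [x] of [j] to neighbours of [k] other than [j], but
    only [l] is available. *)
Lemma square_nflips g i j k l : square i j k l -> ~ flips g j k.
Proof.
case=> [[Eij Ejk Ekl Eli] [ik jl] Nk Nl [[x [Ejx xi xk xl]] _]].
case=> gT gj gk off side.
have gE y z : edge (g y) (g z) = edge y z by apply: edge_conj.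
have gx y : edge j y -> y != k -> g y = l.
  rewrite -gE gj => /Nk[] // gy; rewrite -gk in gy.
  by move/perm_inj: gy => ->; rewrite eqxx.
have Eji : edge j i by rewrite edge_sym.
have := gx x Ejx xk; rewrite -(gx i Eji ik) => /perm_inj xE.
by rewrite xE eqxx in xi.
Qed.

(** A flip would send [j] to [i], while it must fix the edge from [j] to its outside neighbour [x],
    which does not contain [i]. *)
Lemma square_nflips_opp g i j k l : square i j k l -> ~ flips g k l.
Proof.
case=> [[Eij Ejk Ekl Eli] [ik jl] Nk Nl [[x [Ejx xi xk xl]] _]].
case=> gT gk gl off side.
have gE y z : edge (g y) (g z) = edge y z by apply: edge_conj.
have offE y z : y != k -> y != l -> z != k -> z != l -> edge y z ->
    tperm (g y) (g z) = tperm y z.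
  by move=> yk yl zk zl Eyz; rewrite -tpermJ off // tpermD.
have jk := edge_neq Ejk; have il : i != l by rewrite eq_sym edge_neq.
have gji : g j = i.
  have : edge (g j) (g k) by rewrite gE.
  rewrite gk edge_sym => /Nl[] // gjk; rewrite -gl in gjk.
  by move/perm_inj: gjk jl => ->; rewrite eqxx.
have /permP/(_ i) := offE j x jk jl xk xl Ejx.
have ji : j != i by rewrite eq_sym edge_neq.
rewrite gji tpermL tpermD // => gxi.
rewrite -gji in gxi; move/perm_inj: gxi => xj.
by have := edge_neq Ejx; rewrite xj eqxx.
Qed.

Lemma flips_twin g i j : flips g i j -> edge i j ->
  (forall k, k != i -> k != j -> edge i k = edge j k) \/ exists k l, square i j k l.
Proof.
move=> gf Eij.
have [/existsP[k /and3P[ki kj nE]]|/existsPn tw] :=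
  boolP [exists k, [&& k != i, k != j & edge i k != edge j k]]; last first.
  by left=> k ki kj; apply/eqP; move: (tw k); rewrite ki kj negbK.
right; have [ik jk] : i != k /\ j != k by rewrite !(eq_sym _ k).
have Eji : edge j i by rewrite edge_sym.
have [Eik|nEik] := boolP (edge i k); rewrite ?Eik ?(negPf nEik) /= in nE.
  exists (g k), k; apply: square_sym.
  apply: (flips_square (flips_sym gf)) => //; by apply: contraNN nE => ->.
exists k, (g k); apply: (flips_square gf) => //.
by apply: contraR nE => /negPf ->.
Qed.

(** The vertex [i] and its neighbours form a set closed under edges, so it is everything by
    connectedness. *)
Lemma twin_complete i :
    (forall y, edge i y -> forall k, k != i -> k != y -> edge i k = edge y k) ->
  forall x y, x != y -> edge x y.
Proof.
move=> tw.
have nbr x : (x == i) || edge i x.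
  apply: (@edge_connected [pred x | (x == i) || edge i x] i) => /= [|y z].
    by rewrite eqxx.
  case/predU1P=> [->|Eiy] Eyz; first by rewrite Eyz orbT.
  have [//|zi] := eqVneq z i.
  by rewrite (tw y Eiy) ?Eyz // eq_sym edge_neq.
move=> x y; have := nbr x; have := nbr y.
case/predU1P=> [->|Eiy] /predU1P[->|Eix] xy; rewrite ?eqxx // in xy *.
  by rewrite edge_sym.
rewrite -(tw x Eix) // 1?eq_sym //; exact: edge_neq.
Qed.

(** * Variation of the local action over the group *)

Definition cocycle f (phi : {perm X} -> {perm X}) :=
  (forall a s, s \in T -> s ^ phi a \in T) /\
  (forall a s, s \in T -> f (s * a) = s ^ phi a * f a).

Lemma cocycle_exists f : f \in A -> exists phi, cocycle f phi.
Proof.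
move=> fA; have [phi phiE] := fin_all_exists (fun a => local_conj a fA).
by exists phi; split=> a s sT; have [gT gE] := phiE a; [apply: gT | apply: gE].
Qed.

(** Moving [a] and [f a] to 1 and undoing [phi a] brings [f] to the form [fixT], so the dichotomy
    applies at every vertex. *)
Lemma cocycle_rebase f phi a : f \in A -> cocycle f phi ->
  exists2 f', fixT f'
    & forall t, t \in T -> local_at f' t (phi (t * a) * (phi a)^-1).
Proof.
move=> fA [phiT phiE].
have phiVT s : s \in T -> s ^ (phi a)^-1 \in T.
  by move=> sT; rewrite -(conj_memT _ (phiT a)) conjgKV.
pose f' := right_mul a * f * right_mul (f a)^-1 * conj_perm (phi a)^-1.
have f'E b : f' b = (f (b * a) * (f a)^-1) ^ (phi a)^-1.
  by rewrite !permM !right_mulE conj_permE.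
have f'T s : s \in T -> f' s = s.
  by move=> sT; rewrite f'E phiE // mulgK conjgK.
exists f'.
  split=> //; last by rewrite f'E mul1g mulgV conj1g.
  rewrite groupM ?conj_perm_aut ?groupM ?right_mul_aut //;
  first [exact: one_notinT | exact: TV].
move=> t tT; split=> s sT.
  by rewrite conjgM phiVT ?phiT.
have key : f (s * t * a) * (f a)^-1 = s ^ phi (t * a) * (f (t * a) * (f a)^-1).
  by rewrite -(mulgA s t a) (phiE (t * a) s sT) mulgA.
by rewrite -[X in _ = _ * X](f'T t tT) !f'E key conjMg conjgM.
Qed.

Definition still (phi : {perm X} -> {perm X}) i j a :=
  forall s, s \in T -> s ^ phi (tperm i j * a) = s ^ phi a.

Lemma stillE (phi : {perm X} -> {perm X}) i j a :
  still phi i j a <->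
  forall s, s \in T -> s ^ (phi (tperm i j * a) * (phi a)^-1) = s.
Proof.
split=> st s sT; first by rewrite conjgM st // conjgK.
by rewrite -{2}(st s sT) conjgM conjgKV.
Qed.

Lemma local_at_id f t g : fixT f -> t \in T -> local_at f t g -> t ^ g = t.
Proof.
case=> _ f1 fT tT [_ gE]; apply: (mulIg t).
by rewrite -gE // TK.
Qed.

Lemma cocycle_dichotomy f phi i j a : f \in A -> cocycle f phi -> edge i j ->
  still phi i j a \/ exists g, flips g i j.
Proof.
move=> fA phiP Eij; have [f' f'fix f'E] := cocycle_rebase a fA phiP.
have loc := f'E _ Eij.
have [st|fl] := fixT_dichotomy f'fix Eij loc (local_at_id f'fix Eij loc).
  by left; apply/stillE.
by right; exists (phi (tperm i j * a) * (phi a)^-1).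
Qed.

(** If [i j] were flipped, the rebased map would send both [tperm i k * tperm i j] and
    [tperm i j * tperm i k] to the latter, against injectivity. *)
Lemma cocycle_triangle f phi i j k a : f \in A -> cocycle f phi ->
  edge i j -> edge i k -> edge j k -> still phi i k a -> still phi i j a.
Proof.
move=> fA phiP Eij Eik Ejk /stillE still_ik; apply/stillE.
have [f' f'fix f'E] := cocycle_rebase a fA phiP.
have loc := f'E _ Eij; have lock := f'E _ Eik.
have [//|fl] := fixT_dichotomy f'fix Eij loc (local_at_id f'fix Eij loc).
have [ij [ik jk]] := (edge_neq Eij, (edge_neq Eik, edge_neq Ejk)).
have U : uniq [:: i; k; j] by rewrite /= !inE negb_or ij ik eq_sym jk.
case/negP: (tperm_adj_ncommb U); apply/eqP; apply: (@perm_inj _ f').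
rewrite [RHS]lock.2 // [X in _ = X * _]still_ik // loc.2 //.
case: fl => _ gi gj _ side; rewrite tpermJ gi.
have := side k; rewrite Eik Ejk /= !(eq_sym k) ik jk => -> //.
by rewrite (conjgCV (tperm i j)) tpermV (tperm_adjJ U) tpermC.
Qed.

(** As a twin of [i], [j] is adjacent to [l], whose only neighbours are [i] and [k]. So [j] is [k],
    which is not adjacent to [i]. *)
Lemma twin_square i j y k l : edge i j -> edge i y -> y != j ->
    (forall x, x != i -> x != j -> edge i x = edge j x) -> ~ square i y k l.
Proof.
move=> Eij Eiy yj tw [[_ Eyk Ekl Eli] [ik yl] Nk Nl _].
have yi : y != i by rewrite eq_sym edge_neq.
have Ejy : edge j y by rewrite -tw.
have Eil : edge i l by rewrite edge_sym.
have lj : l != j.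
  apply: contraTneq Ejy => lj; apply/negP; rewrite -lj => /Nl[] ye.
    by rewrite ye eqxx in yi.
  by have := edge_neq Eyk; rewrite ye eqxx.
have li := edge_neq Eli.
have : edge l j by rewrite edge_sym -tw.
case/Nl=> je; first by have := edge_neq Eij; rewrite je eqxx.
have : edge k i by rewrite -je edge_sym.
by case/Nk=> ie; [have := edge_neq Eiy | have := edge_neq Eil]; rewrite ie eqxx.
Qed.

(** If [i] and [j] are twins, each other neighbour [y] of [i] closes a triangle with them, so [i y]
    is not still either. It cannot be the base of a square, so [y] is a twin of [i] too and the
    graph is complete. *)
Lemma cocycle_square f phi i j a : f \in A -> cocycle f phi ->
    ~ (forall x y, x != y -> edge x y) -> edge i j -> ~ still phi i j a ->
  exists k l, square i j k l.
Proof.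
move=> fA phiP ncomplete Eij nst.
have [//|[g gf]] := cocycle_dichotomy a fA phiP Eij.
have [tw|//] := flips_twin gf Eij.
case: ncomplete; apply: (@twin_complete i) => y Eiy.
have [->//|yj] := eqVneq y j.
have yi : y != i by rewrite eq_sym edge_neq.
have Ejy : edge j y by rewrite -tw.
have [sty|[g' gf']] := cocycle_dichotomy a fA phiP Eiy.
  by case: nst; apply: (cocycle_triangle fA phiP Eij Eiy Ejy sty).
have [//|[k [l sq]]] := flips_twin gf' Eiy.
by case: (twin_square Eij Eiy yj tw sq).
Qed.

Lemma cocycle_constant f phi : f \in A -> cocycle f phi ->
    ~ (forall x y, x != y -> edge x y) ->
  forall a s, s \in T -> s ^ phi a = s ^ phi 1.
Proof.
move=> fA phiP ncomplete.
pose S :=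
  [set t in T | [forall a, [forall s in T, s ^ phi (t * a) == s ^ phi a]]].
have inS x y : edge x y -> (forall a, still phi x y a) -> tperm x y \in S.
  move=> Exy st; rewrite inE [_ \in T]Exy; apply/forallP=> a.
  apply/forall_inP=> s sT; by apply/eqP; apply: st.
have nfS x y : edge x y -> (forall g, ~ flips g x y) -> tperm x y \in <<S>>.
  move=> Exy nf; apply/mem_gen/inS => // a.
  by have [//|[g /nf]] := cocycle_dichotomy a fA phiP Exy.
have Sgen : <<S>> = setT.
  apply/eqP; rewrite eqEsubset subsetT -Tgen gen_subG; apply/subsetP=> t tT.
  have [tS|] := boolP (t \in S); first exact: mem_gen.
  have [i [j [Eij tE]]] := edge_perm tT.
  rewrite inE tT negb_forall => /existsP[a /forall_inP nst].
  have [|k [l sq]] := cocycle_square (a := a) fA phiP ncomplete Eij.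
    by move=> st; apply: nst => s sT; rewrite tE st.
  have [[_ Ejk Ekl Eli] [ik _] _ _ _] := sq.
  have tS : tperm k l \in <<S>>.
    by apply: nfS => // g; apply: square_nflips_opp sq.
  have jkS : tperm j k \in <<S>>.
    by apply: nfS => // g; apply: square_nflips sq.
  have liS : tperm l i \in <<S>>.
    by apply: nfS => // g /flips_sym; apply: square_nflips (square_sym sq).
  (* The three other sides of the square form a path from [j] to [i], whose conjugates give the
     transposition of its ends. *)
  have -> : t = tperm j k ^ (tperm k l ^ tperm l i).
    have [kj lk] : k != j /\ l != k.
      by split; rewrite eq_sym; apply: edge_neq.
    rewrite (tpermJ k) tpermL (tpermD lk ik) tpermJ tpermL.
    rewrite (tpermD kj (edge_neq Eij)).
    by rewrite tE tpermC.
  by rewrite !groupJ //.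
suff const b a s : s \in T -> s ^ phi (b * a) = s ^ phi a.
  by move=> a s sT; rewrite -[a]mulg1 const.
move: b a s; apply: (sub_gen_ind Sgen) => [a s _|b t]; first by rewrite mul1g.
rewrite inE => /andP[tT /forallP tS] IH a s sT.
by rewrite -mulgA IH //; apply/eqP; move: s sT; apply/forall_inP.
Qed.

(** Once [phi] is constant on [T], induction on words shows that [f] is conjugation by [phi 1]. *)
Lemma noncomplete_stab f : f \in A -> f 1 = 1 ->
  ~ (forall x y, x != y -> edge x y) -> f \in aut_fixing T.
Proof.
move=> fA f1 ncomplete; have [phi phiP] := cocycle_exists fA.
have const := cocycle_constant fA phiP ncomplete; have [phiT phiE] := phiP.
suff fE b a : f (b * a) = b ^ phi 1 * f a.
  have -> : f = conj_perm (phi 1); last exact: conj_perm_aut_fixing (phiT 1).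
  by apply/permP=> b; rewrite conj_permE -[in LHS](mulg1 b) fE f1 !mulg1.
move: b a; apply: (sub_gen_ind Tgen) => [a|b t tT IH a].
  by rewrite conj1g !mul1g.
by rewrite -mulgA IH phiE // const // conjMg mulgA.
Qed.

End TranspositionCayley.

Theorem theorem1 (n : nat) (T : {set 'S_n}) :
  (5 <= n)%N ->
  T \subset transpositions n ->
  <<T>> = [set: 'S_n] ->
  ~ graph_isomorphic (transposition_graph T) (complete_graph 'I_n) ->
  right_regular 'S_n ><| aut_fixing T = graph_aut (cayley_graph T)
  /\ normal_cayley T.
Proof.
move=> n5 /subsetP Ttr Tgen ncomplete.
have Ttp t : t \in T -> is_tperm t.
  move/Ttr/imset2P=> [i j _]; rewrite inE => /andP[_ nij] ->.
  by exists i, j.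
have cardX : 4 < #|'I_n| by rewrite card_ord.
have nE : ~ (forall x y, x != y -> edge T x y).
  (* If all pairs are edges, the identity is an isomorphism onto the complete graph. *)
  move=> allE; apply: ncomplete; exists id; first by exists id.
  apply/setP=> e; rewrite [RHS]inE; apply/imsetP/cards2P.
    case=> _ /imset2P[i j _ + ->] ->; rewrite inE => /and3P[_ nij _].
    by exists i, j; split; rewrite ?imset_id.
  case=> i [j [nij ->]]; exists [set i; j]; last by rewrite imset_id.
  by apply/imset2P; exists i j; rewrite ?inE //= nij [_ \in T]allE.
have sd : right_regular 'S_n ><| aut_fixing T = graph_aut (cayley_graph T).
  apply: cayley_aut_sdprod => [||f fA f1]; [exact: one_notinT | exact: TV |].
  exact: noncomplete_stab.
by split=> //; case/sdprod_context: sd.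
Qed.
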